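(* There exists a function $f:\mathbb{N}\to\mathbb{N}$ such that, for every positive integer $k$ and every connected graph $G$ of pathwidth less than $k$, there is a tree decomposition $(T,(W_x)_{x\in V(T)})$ of $G$ of width at most $f(k)$ such that the indexing tree $T$ is a spanning tree of $G$ (in particular $V(T)=V(G)$ and $T$ is a subgraph of $G$), and moreover $v\in W_v$ for every vertex $v\in V(G)$.
   Context: All graphs are finite, simple and undirected. A tree decomposition of a graph $G$ is a pair $(T,(W_x)_{x\in V(T)})$ where $T$ is a tree and $W_x\subseteq V(G)$, such that for every vertex $u$ of $G$ the set $\{x\in V(T)\mid u\in W_x\}$ induces a nonempty connected subgraph of $T$, and for every edge $uv$ of $G$ there is $x$ with $u,v\in W_x$. Its width is the maximum bag size minus one. The pathwidth of $G$ is the minimum width of a tree decomposition of $G$ whose tree is a path. *)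

(* Defs.v *)
From mathcomp Require Import all_boot.
Set Implicit Arguments. Unset Strict Implicit. Unset Printing Implicit Defensive.

Definition simple_graph (V : finType) (e : rel V) : Prop :=
  symmetric e /\ irreflexive e.

Definition connected_graph (V : finType) (e : rel V) : Prop :=
  0 < #|V| /\ forall x y : V, connect e x y.

Definition acyclic_graph (V : finType) (e : rel V) : Prop :=
  forall s : seq V, uniq s -> 2 < size s -> ~~ cycle e s.

Definition is_tree (V : finType) (e : rel V) : Prop :=
  simple_graph e /\ connected_graph e /\ acyclic_graph e.

Definition is_path_graph (V : finType) (e : rel V) : Prop :=
  is_tree e /\ forall x : V, #|[set y | e x y]| <= 2.

Definition tree_decomposition (V I : finType) (eG : rel V) (eT : rel I)
    (W : I -> {set V}) : Prop :=
  is_tree eT /\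
  (forall u : V,
     (exists x : I, u \in W x) /\
     (forall x y : I, u \in W x -> u \in W y ->
        connect [rel a b | [&& eT a b, u \in W a & u \in W b]] x y)) /\
  (forall u v : V, eG u v -> exists x : I, (u \in W x) && (v \in W x)).

Definition width_le (V I : finType) (W : I -> {set V}) (w : nat) : Prop :=
  forall x : I, #|W x| <= w.+1.

Definition pathwidth_lt (V : finType) (e : rel V) (k : nat) : Prop :=
  exists (I : finType) (eT : rel I) (W : I -> {set V}),
    is_path_graph eT /\ tree_decomposition e eT W /\
    forall x : I, #|W x| <= k.

(* Main.v *)
Require Import Defs.
From mathcomp Require Import all_boot zify.
Set Implicit Arguments. Unset Strict Implicit. Unset Printing Implicit Defensive.

(** A connected graph is decomposed by cutting its path decomposition into
    segments. Two spanning forests with decompositions, of parts meeting in at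
    most [k] vertices, combine: at most [k] edges of the second forest close
    cycles, and for each of them the few vertices whose subtree used it are
    added to the bags along a detour. A segment whose end bags share a vertex is
    handled by removing this vertex and induction on [k]. Otherwise one inducts
    downwards on the rank, the number of components of the segment that meet
    both end bags. A segment of rank [r] is cut greedily into letters of rank
    [r], alternately called blocks and connectors. As the rank is constant along
    the segment, everything left of a connector joins two vertices of its left
    end bag only if the preceding block alone already does, so the detours
    around the edges removed from a connector stay within the two adjacent
    blocks, and no bag grows more than a bounded number of times. *)

(** On [A], [g] factors through [f], so a map [h] carries the values of [f] onto those of [g]; if
    the latter are no fewer, [h] is injective. This serves to compare numbers of components in two
    graphs. *)
Lemma card_coarser (T S1 S2 : finType) (f : T -> S1) (g : T -> S2)
    (A : {set T}) :
  {in A &, forall x y, f x = f y -> g x = g y} ->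
  #|g @: A| <= #|f @: A| /\
  (#|f @: A| <= #|g @: A| -> {in A &, forall x y, g x = g y -> f x = f y}).
Proof.
move=> fg.
pose h s := omap g [pick x in A | f x == s].
have hf x : x \in A -> h (f x) = Some (g x).
  move=> xA; rewrite /h; case: pickP => [y /andP[yA /eqP eqf] | /(_ x)].
    by rewrite /= (fg y x).
  by rewrite xA eqxx.
have Eim : h @: (f @: A) = Some @: (g @: A).
  rewrite -!imset_comp; apply: eq_in_imset => x xA /=; exact: hf.
have Ecard : #|g @: A| = #|h @: (f @: A)|.
  have Some_inj : injective (@Some S2) by move=> u v [].
  by rewrite Eim (card_imset _ Some_inj).
split; first by rewrite Ecard leq_imset_card.
move=> le_fg; have /imset_injP hinj : #|h @: (f @: A)| == #|f @: A|.
  by rewrite eqn_leq leq_imset_card -Ecard.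
move=> x y xA yA eqg; by apply: hinj; rewrite ?imset_f // !hf // eqg.
Qed.

(** * Connectivity and forests when edges are added or deleted *)

Section Connectivity.
Variable V : finType.
Implicit Types (F G : rel V) (A : {set V}).

Lemma connect_ind F (P : V -> Prop) x :
  P x -> (forall y z, P y -> F y z -> P z) -> forall y, connect F x y -> P y.
Proof.
move=> Px PF y /connectP[p pth ->].
elim: p x Px pth => //= z p IHp x Px /andP[xz pth].
by apply: IHp => //; apply: PF xz.
Qed.

Lemma connect_mono F G : subrel F G -> subrel (connect F) (connect G).
Proof. by move=> FG; apply: connect_sub => x y /FG/connect1. Qed.

Definition cl F x := [set y | connect F x y].

Lemma eq_clP F x y : symmetric F -> reflect (cl F x = cl F y) (connect F x y).
Proof.
move=> /sym_connect_sym sF; apply: (iffP idP) => [xy | eqc].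
  by apply/setP=> z; rewrite !inE (same_connect sF xy).
have: y \in cl F y by rewrite inE connect0.
by rewrite -eqc inE.
Qed.

Definition add_edge F a b x y :=
  F x y || ((x == a) && (y == b) || (x == b) && (y == a)).
Definition del_edge F a b x y :=
  F x y && ~~ ((x == a) && (y == b) || (x == b) && (y == a)).
#[global] Arguments add_edge F a b x y /.
#[global] Arguments del_edge F a b x y /.

(** Acyclicity in the form used by exchange arguments: every edge is a bridge. [forest_acyclic]
    returns to cycles. *)
Definition forest F := forall a b, F a b -> ~~ connect (del_edge F a b) a b.

Lemma add_edge_sym F a b : symmetric F -> symmetric (add_edge F a b).
Proof.
move=> sF x y /=; rewrite sF; congr orb.
by rewrite orbC; congr orb; rewrite andbC.
Qed.

Lemma del_edge_sym F a b : symmetric F -> symmetric (del_edge F a b).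
Proof.
move=> sF x y /=; rewrite sF; congr (_ && ~~ _).
by rewrite orbC; congr orb; rewrite andbC.
Qed.

Lemma connect_add_edge F a b x y : symmetric F -> connect (add_edge F a b) x y ->
  [\/ connect F x y, connect F x a /\ connect F b y
     | connect F x b /\ connect F a y].
Proof.
move=> sF; move: y; apply: connect_ind => [|y z IH /orP[Fyz | yz]].
- by constructor 1; rewrite connect0.
- have yz := connect1 Fyz.
  case: IH => [xy | [xa by_] | [xb ay]].
  + by constructor 1; apply: connect_trans yz.
  + by constructor 2; split=> //; apply: connect_trans yz.
  + by constructor 3; split=> //; apply: connect_trans yz.
- case/orP: yz IH => /andP[/eqP-> /eqP->].
  + by case=> [xa | [xa _] | [xb _]];
      [constructor 2 | constructor 2 | constructor 1].
  + by case=> [xa | [xa _] | [xb _]];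
      [constructor 3 | constructor 1 | constructor 3].
Qed.

(** If another edge [c d] stopped being a bridge, a detour around it would use [a b], and the rest
    of this detour together with [c d] would already link [a] to [b] in [F]. *)
Lemma forest_add_edge F a b : symmetric F -> forest F -> ~~ connect F a b ->
  forest (add_edge F a b).
Proof.
move=> sF fF nab c d; have csF := sym_connect_sym sF.
case: (boolP ((c == a) && (d == b) || (c == b) && (d == a))) => [cd _ | ncd].
  have cF : connect F c d = connect F a b.
    by case/orP: cd => /andP[/eqP-> /eqP->] //; rewrite csF.
  apply: contra nab; rewrite -cF; apply: connect_mono => x y /=.
  case/andP=> /orP[//|xy]; case/negP.
  case/orP: cd xy => /andP[/eqP-> /eqP->] //.
  by rewrite orbC.
move=> /= /orP[Fcd | ]; last by rewrite (negPf ncd).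
have sD := del_edge_sym c d sF.
have DF : subrel (connect (del_edge F c d)) (connect F).
  by apply: connect_mono => x y /andP[].
apply/negP=> cn.
have {cn}: connect (add_edge (del_edge F c d) a b) c d.
  apply: connect_mono cn => x y /=.
  by case/andP=> /orP[->|->] ncd'; rewrite ?ncd' ?orbT.
case/(connect_add_edge sD) => [cd | [ca bd] | [cb ad]].
- by case/negP: (fF _ _ Fcd).
- case/negP: nab; rewrite csF.
  apply: connect_trans (DF _ _ ca); apply: connect_trans (DF _ _ bd) _.
  by apply: connect1; rewrite sF.
- case/negP: nab; apply: connect_trans (DF _ _ cb).
  apply: connect_trans (DF _ _ ad) _.
  by apply: connect1; rewrite sF.
Qed.

(** The rest of a cycle through the edge [x y] links its ends without using this edge. *)
Lemma forest_acyclic F : symmetric F -> forest F -> acyclic_graph F.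
Proof.
move=> sF fF [//|x [//|y s]] uniq_s size_s; apply/negP=> /= /andP[xy pth].
case/negP: (fF x y xy).
rewrite sym_connect_sym; last exact: del_edge_sym.
case: s uniq_s size_s pth => [//|z s] /= /andP[].
rewrite !inE !negb_or => /and3P[nxy nxz nxs] /andP[/andP[nyz nys] _] _.
case/andP=> yz pth; apply: (@connect_trans _ _ z).
  apply: connect1; rewrite /= yz /= (eq_sym y x) (negPf nxy) eqxx /=.
  by rewrite eq_sym (negPf nxz).
apply/connectP; exists (rcons s x); last by rewrite last_rcons.
apply: (@sub_in_path _ (predC1 y) F) pth => [u v|].
  by rewrite !inE => nuy nvy /= ->; rewrite (negPf nuy) (negPf nvy) andbF.
rewrite /= eq_sym nyz all_rcons /= nxy.
by apply/allP=> u us /=; apply: contraNneq nys => <-.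
Qed.

(** The edges of [F1] are scanned one by one and kept when they join two components. As [F0] is kept
    whole, only edges of [F1] are ever dropped. *)
Lemma kruskal F0 F1 : symmetric F0 -> forest F0 -> symmetric F1 ->
  exists F, [/\ symmetric F, forest F, subrel F0 F, subrel F (relU F0 F1)
              & subrel F1 (connect F)].
Proof.
move=> sF0 fF0 sF1.
suff [F [sF fF F0F FF cF]]: exists F, [/\ symmetric F, forest F, subrel F0 F,
    subrel F (relU F0 F1)
    & {in enum [set d | F1 d.1 d.2], forall d, connect F d.1 d.2}].
  exists F; split=> // x y xy; apply: (cF (x, y)).
  by rewrite mem_enum inE.
have: {subset enum [set d | F1 d.1 d.2] <= [set d | F1 d.1 d.2]}.
  by move=> d; rewrite mem_enum.
elim: (enum _) => [|[a b] s IHs] sub.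
  by exists F0; split=> // x y /= ->.
case: IHs => [d ds|F [sF fF F0F FF cF]].
  by apply: sub; rewrite inE ds orbT.
have ab : F1 a b by have := sub (a, b); rewrite !inE eqxx; apply.
case: (boolP (connect F a b)) => [cab | nab].
  by exists F; split=> // d; rewrite inE => /orP[/eqP->|/cF].
exists (add_edge F a b); split.
- exact: add_edge_sym.
- exact: forest_add_edge.
- by move=> x y /F0F /= ->.
- move=> x y /orP[/FF //|/orP[] /andP[/eqP-> /eqP->] /=].
    by rewrite ab orbT.
  by rewrite sF1 ab orbT.
- move=> d; rewrite inE => /orP[/eqP->|/cF].
    by apply: connect1; rewrite /= !eqxx orbT.
  by apply: connect_mono => x y /= ->.
Qed.

(** The number of components of [F] that meet [A]. *)
Definition ncl F A := #|cl F @: A|.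

Lemma ncl_add_edge F A a b a' b' : symmetric F -> ~~ connect F a b ->
  a' \in A -> b' \in A -> connect F a a' -> connect F b b' ->
  ncl (add_edge F a b) A < ncl F A.
Proof.
move=> sF nab a'A b'A aa' bb'; have csF := sym_connect_sym sF.
have sF' := add_edge_sym a b sF.
have FF' : subrel (connect F) (connect (add_edge F a b)).
  by apply: connect_mono => x y /= ->.
have fg: {in A &, forall x y, cl F x = cl F y ->
    cl (add_edge F a b) x = cl (add_edge F a b) y}.
  by move=> x y _ _ /(eq_clP _ _ sF)/FF'/(eq_clP _ _ sF').
have [_ inj] := card_coarser fg.
rewrite ltnNge; apply: contra nab => /inj /(_ a' b' a'A b'A) ab'.
have /(eq_clP _ _ sF) cab' : cl F a' = cl F b'.
  apply/ab'/(eq_clP _ _ sF').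
  apply: (@connect_trans _ _ a); first by apply: FF'; rewrite csF.
  apply: (@connect_trans _ _ b); last exact: FF'.
  by apply: connect1; rewrite /= !eqxx orbT.
by apply: connect_trans aa' _; apply: connect_trans cab' _; rewrite csF.
Qed.

(* Reinserting the deleted edges one by one, each merges two classes of [A]. *)
Lemma deleted_edges_leq F G A : symmetric F -> forest F -> symmetric G ->
  subrel G F ->
  (forall a b, F a b -> ~~ G a b -> exists2 c, c \in A & connect G a c) ->
  #|[set d | F d.1 d.2 && ~~ G d.1 d.2]| <= 2 * #|A|.
Proof.
move=> sF fF sG GF toA.
(* The factor 2 is due to each edge being counted in both orientations. *)
suff: #|[set d | F d.1 d.2 && ~~ G d.1 d.2]| <= 2 * ncl G A.
  by move/leq_trans; apply; rewrite leq_mul2l /= leq_imset_card.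
have [n] := ubnP #|[set d | F d.1 d.2 && ~~ G d.1 d.2]|.
elim: n G sG GF toA => // n IHn G sG GF toA le_n.
have [-> | [[a b]]] := set_0Vmem [set d | F d.1 d.2 && ~~ G d.1 d.2].
  by rewrite cards0.
rewrite inE /= => /andP[Fab nGab].
have [a' a'A aa'] := toA a b Fab nGab.
have [b' b'A bb'] : exists2 c, c \in A & connect G b c.
  by apply: (toA b a); rewrite 1?sF 1?sG.
have nab : ~~ connect G a b.
  apply: contra (fF a b Fab); apply: connect_mono => x y Gxy /=.
  rewrite GF //=; apply: contra nGab => /orP[] /andP[/eqP<- /eqP<-] //.
  by rewrite sG.
have lt_ncl := ncl_add_edge sG nab a'A b'A aa' bb'.
have ne_ab : a != b by apply: contra nab => /eqP->; rewrite connect0.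
set D := [set d | _] in le_n *.
pose D' := [set d | F d.1 d.2 && ~~ add_edge G a b d.1 d.2].
have eD' : D' = D :\: [set (a, b); (b, a)].
  apply/setP=> -[x y]; rewrite !inE /= !xpair_eqE.
  by case: (F x y); case: (G x y); rewrite ?andbF ?andbT //= ?andbT.
have cD' : #|D'| + 2 = #|D|.
  have <- : #|[set (a, b); (b, a)]| = 2 by rewrite cards2 xpair_eqE (negPf ne_ab).
  rewrite addnC eD' -(cardsID [set (a, b); (b, a)] D); congr (_ + _).
  rewrite (setIidPr _) //; apply/subsetP=> d.
  by rewrite !inE => /orP[] /eqP-> /=; rewrite ?Fab // sF sG Fab.
suff leD': #|D'| <= 2 * ncl (add_edge G a b) A.
  rewrite -cD' addn2; apply: (@leq_trans (2 * (ncl (add_edge G a b) A).+1)).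
    by rewrite mulnS add2n !ltnS.
  by rewrite leq_mul2l.
apply: IHn; [exact: add_edge_sym | | |
  by rewrite -/D' -ltnS (leq_trans _ le_n) // -cD' addn2].
  by move=> x y /orP[/GF //|/orP[] /andP[/eqP-> /eqP->] //]; rewrite sF.
move=> x y Fxy; rewrite negb_or => /andP[nGxy _].
have [c cA xc] := toA x y Fxy nGxy; exists c => //.
by apply: connect_mono xc => u v /= ->.
Qed.

End Connectivity.

(** * Forest decompositions: gluing two parts, adding a vertex *)

Section Decompositions.
Variable V : finType.
Implicit Types (E F : rel V) (X Y Z : {set V}) (W : V -> {set V}).

Definition bag_rel F W u : rel V :=
  fun a b => [&& F a b, u \in W a & u \in W b].
#[global] Arguments bag_rel F W u a b /.

(** Connectedness of the set of nodes whose bag holds [u], rooted at the node [u] itself. *)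
Definition linked F W :=
  forall u x, u \in W x -> connect (bag_rel F W u) u x.

(** The nodes are all of [V]: those outside [X] are isolated and have empty bags, so decompositions
    of different parts live on the same type and can be united. *)
Record forest_decomposition E X F W : Prop := ForestDecomposition {
  fd_supp : forall x y, E x y -> (x \in X) && (y \in X);
  fd_sym : symmetric F;
  fd_sub : subrel F E;
  fd_forest : forest F;
  fd_span : subrel E (connect F);
  fd_self : forall x, x \in X -> x \in W x;
  fd_bag : forall x, W x \subset X;
  fd_linked : linked F W;
  fd_cover : forall u v, E u v -> exists x, (u \in W x) && (v \in W x)
}.

Lemma eq_forest_decomposition E E' X F W : E =2 E' ->
  forest_decomposition E X F W -> forest_decomposition E' X F W.
Proof.
move=> eE [h1 h2 h3 h4 h5 h6 h7 h8 h9]; split=> //.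
- by move=> x y; rewrite -eE; apply: h1.
- by move=> x y /h3; rewrite eE.
- by move=> x y; rewrite -eE; apply: h5.
- by move=> x y; rewrite -eE; apply: h9.
Qed.

Lemma fd_connect_in E X F W x y : forest_decomposition E X F W ->
  x \in X -> connect F x y -> y \in X.
Proof.
move=> D xX; move: y; apply: connect_ind => // y z _ /(fd_sub D) /(fd_supp D).
by case/andP.
Qed.

Lemma fd_bag0 E X F W x : forest_decomposition E X F W -> x \notin X -> W x = set0.
Proof.
move=> D nxX; apply/setP=> u; rewrite inE; apply: contraNF nxX => uWx.
have uX := subsetP (fd_bag D x) u uWx.
apply: (fd_connect_in D uX).
by apply: connect_mono (fd_linked D uWx) => a b /and3P[].
Qed.

(* [F00] is a part of [F0], near [Y], that realises all the connections [F0]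
   makes inside [X :&: Y]; only bags on [Y] and on [F00] grow. *)
Lemma glue E0 X F0 W0 E1 Y F1 W1 F00 Z w :
  forest_decomposition E0 X F0 W0 -> forest_decomposition E1 Y F1 W1 ->
  symmetric F00 -> subrel F00 F0 -> (forall x y, F00 x y -> y \in Z) ->
  {in X :&: Y &, forall x y, connect F0 x y -> connect F00 x y} ->
  (forall x, #|W1 x| <= w) ->
  exists F W,
    [/\ forest_decomposition (relU E0 E1) (X :|: Y) F W, subrel F0 F,
        X :&: Y = set0 -> subrel F1 F,
        forall x, #|W x| <= #|W0 x| + #|W1 x| + 2 * #|X :&: Y| * w
      & forall x, x \notin Y -> x \notin Z -> W x = W0 x].
Proof.
move=> D0 D1 sF00 F00F0 F00Z F00c leW1.
have [F [sF fF F0F FU cF1]] :=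
  kruskal (fd_sym D0) (fd_forest D0) (fd_sym D1).
(* [G] holds the edges of [F1] that survive; detours run in [Fr], which joins them with [F00]. *)
pose G : rel V := fun x y => F1 x y && F x y.
have sG : symmetric G by move=> x y; rewrite /G (fd_sym D1) sF.
have csG := sym_connect_sym sG.
pose Fr := relU F00 G.
have sFr : symmetric Fr by move=> x y; rewrite /Fr /= sF00 sG.
have csFr := sym_connect_sym sFr.
have FrF : subrel Fr F by move=> x y /orP[/F00F0/F0F|/andP[]].
have F0X x y : F0 x y -> (x \in X) && (y \in X).
  by move/(fd_sub D0)/(fd_supp D0).
have F1Y x y : F1 x y -> (x \in Y) && (y \in Y).
  by move/(fd_sub D1)/(fd_supp D1).
(* An excursion of the walk into [F0] starts and ends in [X :&: Y], so [F00] can replace it. *)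
have surgery x y : x \in Y -> y \in Y -> connect F x y -> connect Fr x y.
  move=> xY yY xy.
  have F00_Fr a b : a \in X :&: Y -> b \in X :&: Y -> connect F0 a b ->
      connect Fr a b.
    by move=> aA bA /(F00c a b aA bA); apply: connect_mono => u v /= ->.
  have: (y \in Y /\ connect Fr x y) \/ (y \in X /\ exists2 a, a \in X :&: Y &
      connect Fr x a /\ connect F0 a y).
    move: y xy {yY}; apply: connect_ind => [|y z IH Fyz].
      by left; rewrite connect0.
    have [F0yz | F1yz] := orP (FU _ _ Fyz).
      have /andP[yX zX] := F0X _ _ F0yz.
      right; split=> //; case: IH => [[yY xy] | [_ [a aA [xa ay]]]].
        by exists y; [rewrite inE yX | rewrite xy connect1].
      by exists a => //; split=> //; apply: connect_trans (connect1 F0yz).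
    have /andP[yY zY] := F1Y _ _ F1yz.
    left; split=> //; apply: (@connect_trans _ _ y); last first.
      by apply: connect1; rewrite /Fr /= /G F1yz Fyz orbT.
    case: IH => [[] // | [yX [a aA [xa ay]]]].
    by apply: connect_trans xa _; apply: F00_Fr => //; rewrite inE yX.
  case=> [[] // | [yX [a aA [xa ay]]]].
  by apply: connect_trans xa _; apply: F00_Fr => //; rewrite inE yX.
pose D := [set d | F1 d.1 d.2 && ~~ F d.1 d.2].
have cardD : #|D| <= 2 * #|X :&: Y|.
  have -> : D = [set d | F1 d.1 d.2 && ~~ G d.1 d.2].
    by apply/setP=> d; rewrite !inE /G; case: (F1 _ _).
  apply: deleted_edges_leq => //; [exact: fd_sym D1|exact: fd_forest D1| |].
    by move=> x y /andP[].
  (* A walk in [F] from [a] to [b] that stayed in [G] would bypass the edge [a b] of the forest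
     [F1]; hence it has a first edge in [F0], which starts in [X :&: Y]. *)
  move=> a b F1ab nGab; have /andP[aY _] := F1Y _ _ F1ab.
  have: connect G a b \/ exists2 c, c \in X :&: Y & connect G a c.
    move: (b) (cF1 _ _ F1ab); apply: connect_ind => [|y z IH Fyz].
      by left; rewrite connect0.
    case: IH => [ay | ]; last by right.
    have [F0yz | F1yz] := orP (FU _ _ Fyz); last first.
      left; apply: connect_trans ay _.
      by apply: connect1; rewrite /G F1yz Fyz.
    right; exists y => //; have /andP[yX _] := F0X _ _ F0yz.
    rewrite inE yX; apply: (fd_connect_in D1 aY).
    by apply: connect_mono ay => u v /andP[].
  case=> // Gab; case/negP: (fd_forest D1 F1ab).
  apply: connect_mono Gab => x y Gxy /=; have /andP[-> _] := Gxy.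
  apply: contra nGab => /orP[] /andP[/eqP<- /eqP<-] //.
  by rewrite sG.
(* The subtrees that used a dropped edge belong to the vertices common to its two end bags; these
   are added on the whole component of [Fr] that holds the edge's ends. *)
pose R x := \bigcup_(d in D | connect Fr d.1 x) (W1 d.1 :&: W1 d.2).
pose W x := W0 x :|: W1 x :|: R x.
have inW u x : u \in W x -> [\/ u \in W0 x, u \in W1 x | exists a b,
    [/\ F1 a b, ~~ F a b, connect Fr a x, u \in W1 a & u \in W1 b]].
  case/setUP => [/setUP[]|]; [by constructor 1|by constructor 2|].
  case/bigcupP=> -[a b] /andP[]; rewrite inE /= => /andP[F1ab nF] ax.
  by rewrite inE => /andP[ua ub]; constructor 3; exists a, b.
have W0W u x : u \in W0 x -> u \in W x by rewrite !inE => ->.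
have W1W u x : u \in W1 x -> u \in W x by rewrite !inE => ->; rewrite orbT.
have RW u a b x : F1 a b -> ~~ F a b -> connect Fr a x -> u \in W1 a ->
    u \in W1 b -> u \in W x.
  move=> F1ab nF ax ua ub; apply/setUP; right; apply/bigcupP.
  by exists (a, b); rewrite ?inE /= ?F1ab ?nF ?ua.
have cFr u a b x : F1 a b -> ~~ F a b -> u \in W1 a -> u \in W1 b ->
    connect Fr a x -> connect (bag_rel F W u) a x.
  move=> F1ab nF ua ub ax.
  suff [] : connect (bag_rel F W u) a x /\ connect Fr a x by [].
  move: x ax; apply: connect_ind => [|y z [IH ay] Fryz]; first by rewrite !connect0.
  have az := connect_trans ay (connect1 Fryz).
  split=> //; apply: connect_trans IH (connect1 _).
  by rewrite /= FrF // (RW u a b y) // (RW u a b z).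
(* The walk given by [F1] is kept, except that each dropped edge is replaced by a walk in [Fr]. *)
have cW1 u x : u \in W1 x -> connect (bag_rel F W u) u x.
  move/(fd_linked D1); move: x; apply: connect_ind => [|a b IH /and3P[F1ab ua ub]].
    exact: connect0.
  apply: connect_trans IH _.
  case: (boolP (F a b)) => [Fab | nF].
    by apply: connect1; rewrite /= Fab !W1W.
  apply: (cFr u a b) => //; have /andP[aY bY] := F1Y _ _ F1ab.
  by apply: surgery => //; apply: cF1.
exists F, W; split=> //.
- split=> //.
  + by move=> x y /orP[/(fd_supp D0)|/(fd_supp D1)] /andP[xX yX];
      rewrite !inE xX yX ?orbT.
  + move=> x y /FU/orP[/(fd_sub D0)|/(fd_sub D1)] /= -> //.
    by rewrite orbT.
  + move=> x y /orP[/(fd_span D0)|/(fd_span D1)].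
      exact: connect_mono.
    by apply: connect_sub.
  + by move=> x /setUP[/(fd_self D0)/W0W|/(fd_self D1)/W1W].
  + move=> x; apply/subsetP=> u /inW[].
    * by move/(subsetP (fd_bag D0 x)) => h; rewrite inE h.
    * by move/(subsetP (fd_bag D1 x)) => h; rewrite inE h orbT.
    * case=> a [b [_ _ _ /(subsetP (fd_bag D1 a)) h _]].
      by rewrite inE h orbT.
  + move=> u x /inW[/(fd_linked D0) | /cW1 // | ].
      by apply: connect_mono => a b /and3P[/F0F Fab /W0W ua /W0W ub]; apply/and3P.
    case=> a [b [F1ab nF ax ua ub]].
    exact: connect_trans (cW1 _ _ ua) (cFr u a b x F1ab nF ua ub ax).
  + move=> u v /orP[/(fd_cover D0)|/(fd_cover D1)] [x /andP[ux vx]]; exists x.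
      by rewrite !W0W.
    by rewrite !W1W.
(* Without common vertices, [cardD] leaves no dropped edge. *)
- move=> XY0 x y F1xy; apply: contraLR cardD => nF.
  rewrite -ltnNge XY0 cards0 muln0 card_gt0; apply/set0Pn.
  by exists (x, y); rewrite inE /= F1xy.
- move=> x; apply: (leq_trans (leq_card_setU _ _)).
  apply: leq_add; first exact: leq_card_setU.
  apply: (@leq_trans (\sum_(d in D) w)); last first.
    by rewrite sum_nat_const leq_mul2r cardD orbT.
  have le_bigU (P : pred (V * V)) (B : V * V -> {set V}) :
      #|\bigcup_(d in D | P d) B d| <= \sum_(d in D | P d) #|B d|.
    elim/big_rec2: _ => [|d m U _ le]; first by rewrite cards0.
    by apply: (leq_trans (leq_card_setU _ _)); rewrite leq_add2l.
  apply: (leq_trans (le_bigU _ _)).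
  rewrite big_mkcondr /=; apply: leq_sum => d _; case: ifP => // _.
  exact: leq_trans (subset_leq_card (subsetIl _ _)) (leW1 _).
- move=> x nxY nxZ; apply/setP=> u; apply/idP/idP; last exact: W0W.
  case/inW => //; first by rewrite (fd_bag0 D1 nxY) inE.
  case=> a [b [F1ab _ ax _ _]].
  have /andP[aY _] := F1Y _ _ F1ab.
  (* A component of [Fr] that meets [Y] lies within [Y :|: Z]. *)
  have: x \in Y \/ x \in Z.
    move: x ax {nxY nxZ}; apply: connect_ind => [|y z _ /orP[/F00Z|]]; auto.
    by case/andP=> /F1Y /andP[]; auto.
  by case=> h; [rewrite h in nxY | rewrite h in nxZ].
Qed.

Variable e : rel V.
Hypothesis sym_e : symmetric e.
Hypothesis irr_e : irreflexive e.

Definition induced X : rel V := fun x y => [&& e x y, x \in X & y \in X].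
#[global] Arguments induced X x y /.

Lemma induced_sym X : symmetric (induced X).
Proof. by move=> x y /=; rewrite sym_e andbA andbAC -andbA. Qed.

Definition decomposable w X :=
  exists F W, forest_decomposition (induced X) X F W /\ forall x, #|W x| <= w.

Lemma decomposable_leq w w' X : w <= w' -> decomposable w X -> decomposable w' X.
Proof.
by move=> le [F [W [D leW]]]; exists F, W; split=> // x; apply: leq_trans le.
Qed.

Lemma decomposable0 : decomposable 0 set0.
Proof.
exists (fun _ _ => false), (fun=> set0).
split; last by move=> x; rewrite cards0.
split=> //; do ?by move=> x y /and3P[_]; rewrite inE.
- by move=> u x; rewrite inE.
Qed.

(** The forest of [X :\ p] is extended by edges at [p], and [p] joins every bag of its new
    component. All its neighbours in [X] lie there, so the edges at [p] are covered. *)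
Lemma decomposable_add_vertex w X p :
  p \in X -> decomposable w (X :\ p) -> decomposable w.+1 X.
Proof.
move=> pX [F0 [W0 [D leW]]].
pose F1 : rel V := fun x y => induced X x y && ((x == p) || (y == p)).
have sF1 : symmetric F1 by move=> x y; rewrite /F1 induced_sym orbC.
have [F [sF fF F0F FU cF1]] := kruskal (fd_sym D) (fd_forest D) sF1.
have FX : subrel F (induced X).
  move=> x y /FU /orP[/(fd_sub D) /and3P[exy /setD1P[_ xX] /setD1P[_ yX]]|/andP[] //].
  by rewrite /= exy xX.
pose W x := W0 x :|: (if connect F p x then [set p] else set0).
have inW u x : u \in W x -> u \in W0 x \/ u = p /\ connect F p x.
  rewrite inE; case: ifP => _; rewrite ?inE => /orP[|]; auto.
  by move/eqP; auto.
have W0W u x : u \in W0 x -> u \in W x by rewrite inE => ->.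
have pW x : connect F p x -> p \in W x.
  by move=> px; rewrite inE px !inE eqxx orbT.
have Wp : p \in W p by rewrite pW ?connect0.
exists F, W; split; last first.
  move=> x; apply: (leq_trans (leq_card_setU _ _)).
  rewrite -addn1; apply: leq_add => //.
  by case: ifP; rewrite ?cards1 ?cards0.
split=> //.
- by move=> x y /and3P[_ -> ->].
- move=> x y Exy; case: (boolP (F1 x y)) => [/cF1 // | nF1].
  apply: connect_mono F0F _ _ _; apply: (fd_span D).
  move: Exy nF1; rewrite /F1 => Exy; rewrite Exy /= negb_or => /andP[nx ny].
  by move: Exy; rewrite /= !inE nx ny.
- move=> x xX; have [->|nxp] := eqVneq x p; first by [].
  by apply/W0W/(fd_self D); rewrite !inE nxp.
- move=> x; apply/subsetP=> u /inW[|[-> //]].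
  by move/(subsetP (fd_bag D x)) /setD1P=> [].
- move=> u x /inW[/(fd_linked D) | [->]].
    by apply: connect_mono => a b /and3P[/F0F Fab /W0W ua /W0W ub]; apply/and3P.
  move=> px.
  suff [] : connect (bag_rel F W p) p x /\ connect F p x by [].
  move: x px; apply: connect_ind => [|y z [IH ay] Fyz]; first by rewrite !connect0.
  have az := connect_trans ay (connect1 Fyz).
  split=> //; apply: connect_trans IH (connect1 _).
  by rewrite /= Fyz !pW.
- move=> u v Euv.
  have [up | nup] := eqVneq u p.
    subst u; exists v; rewrite pW ?cF1 //= ?/F1 ?Euv ?eqxx //.
    apply/W0W/(fd_self D); case/and3P: Euv => epv _ vX.
    by rewrite !inE vX andbT; apply: contraTneq epv => ->; rewrite irr_e.
  have [vp | nvp] := eqVneq v p.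
    subst v; exists u; rewrite andbC pW /=; last first.
      by apply: cF1; rewrite /F1 induced_sym Euv eqxx.
    apply/W0W/(fd_self D); case/and3P: Euv => epv uX _.
    by rewrite !inE uX nup.
  have [|x /andP[ux vx]] := fd_cover D (u := u) (v := v).
    by move: Euv; rewrite /= !inE nup nvp.
  by exists x; rewrite !W0W.
Qed.

Lemma decomposable_card X : decomposable #|X| X.
Proof.
have [n] := ubnP #|X|; elim: n X => // n IHn X; rewrite ltnS => leX.
have [-> | [p pX]] := set_0Vmem X.
  by rewrite cards0; apply: decomposable0.
rewrite (cardsD1 p) pX add1n; apply: (decomposable_add_vertex pX).
by apply: IHn; move: leX; rewrite (cardsD1 p) pX.
Qed.

(** Gluing with [F00] equal to all of [F0], so detours are not confined. No edge joins [X :\: Y] to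
    [Y :\: X], so every edge of the union lies in one of the parts. *)
Lemma decomposableU w0 w1 X Y :
  (forall x y, x \in X -> y \in Y -> e x y -> (x \in Y) || (y \in X)) ->
  decomposable w0 X -> decomposable w1 Y ->
  decomposable (w0 + w1 + 2 * #|X :&: Y| * w1) (X :|: Y).
Proof.
move=> sep [F0 [W0 [D0 leW0]]] [F1 [W1 [D1 leW1]]].
have F0X x y : F0 x y -> y \in X by move/(fd_sub D0)/(fd_supp D0)/andP=> [].
have [//|F [W [D _ _ leW _]]] :=
  glue D0 D1 (fd_sym D0) (fun _ _ h => h) F0X _ leW1.
exists F, W; split.
  apply: eq_forest_decomposition D => x y /=; rewrite !inE.
  case exy: (e x y) => //=.
  have := sep x y; have := sep y x; rewrite (sym_e y) exy.
  case: (x \in X); case: (y \in Y); case: (y \in X); case: (x \in Y) => //=;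
    by do ?[move=> /(_ isT isT isT) // | move=> _ //].
move=> x; apply: leq_trans (leW x) _.
by rewrite leq_add2r leq_add.
Qed.

End Decompositions.

(** * The rank of a part between two boundary sets *)

Section Rank.
Variables (V : finType) (e : rel V).
Hypothesis sym_e : symmetric e.
Implicit Types (X L P C : {set V}).

Definition reached X P C :=
  [set c in C | [exists p in P, connect (induced e X) p c]].

(** The components meeting both [P] and [C] are counted through their vertices in [C]; by [rankC]
    either side would do. *)
Definition rank X P C := #|cl (induced e X) @: reached X P C|.

Lemma rank_leq_card X P C : rank X P C <= #|C|.
Proof.
apply: (leq_trans (leq_imset_card _ _)); apply: subset_leq_card.
by apply/subsetP=> x /setIdP[].
Qed.

Lemma rankC X P C : rank X P C = rank X C P.
Proof.
suff sub P' C' : cl (induced e X) @: reached X P' C' \subset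
                 cl (induced e X) @: reached X C' P'.
  by congr #|pred_of_set _|; apply/eqP; rewrite eqEsubset !sub.
have sX := induced_sym sym_e X.
apply/subsetP=> _ /imsetP[c /setIdP[cC /existsP[p /andP[pP pc]]] ->].
apply/imsetP; exists p; last by apply/esym/eq_clP.
rewrite inE pP; apply/existsP; exists c.
by rewrite cC sym_connect_sym.
Qed.

(** [P] guards the exits of [L]: the first step of the walk out of [L] has to start in [P]. *)
Lemma connect_exit X L P c z :
  (forall y z, y \in L -> z \in X -> e y z -> (y \in P) || (z \in L)) ->
  c \in L -> connect (induced e X) c z ->
  z \in L /\ connect (induced e L) c z \/
  exists2 b, b \in P & connect (induced e L) c b.
Proof.
move=> sep cL; move: z; apply: connect_ind => [|y z IH /and3P[eyz _ zX]].
  by left; rewrite connect0.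
case: IH => [[yL cy] | ]; last by right.
have [yP | zL] := orP (sep _ _ yL zX eyz); first by right; exists y.
by left; split=> //; apply: connect_trans cy (connect1 _); rewrite /= eyz yL.
Qed.

(* When the ranks agree, passing from [L] to [X] merges no two components of
   [L] that meet both [P] and [C], so it creates no connection inside [C]. *)
Lemma rank_sub X L P0 P C :
  L \subset X ->
  (forall y z, y \in L -> z \in X -> e y z -> (y \in P) || (z \in L)) ->
  C \subset L -> P0 :&: L \subset P ->
  rank X P0 C <= rank L P C /\
  (rank L P C <= rank X P0 C ->
   {in C &, forall x y, connect (induced e X) x y -> connect (induced e L) x y}).
Proof.
move=> LX sep CL P0L.
have sX := induced_sym sym_e X; have sL := induced_sym sym_e L.
have csX := sym_connect_sym sX; have csL := sym_connect_sym sL.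
have iLX : subrel (connect (induced e L)) (connect (induced e X)).
  apply: connect_mono => x y /and3P[exy xL yL].
  by rewrite /= exy !(subsetP LX).
have toP c p : c \in C -> p \in P0 -> connect (induced e X) c p ->
    exists2 b, b \in P & connect (induced e L) c b.
  move=> cC pP0 /(connect_exit sep (subsetP CL c cC)) [[pL cp] | //].
  by exists p => //; apply: (subsetP P0L); rewrite inE pP0.
(* The rank in [X] counts fewer vertices of [C], up to a coarser relation; equality of the ranks
   makes this relation no coarser on the vertices counted in [L]. *)
have sub : reached X P0 C \subset reached L P C.
  apply/subsetP=> c /setIdP[cC /existsP[p /andP[pP0 pc]]].
  rewrite csX in pc; have [b bP cb] := toP c p cC pP0 pc.
  by rewrite inE cC; apply/existsP; exists b; rewrite bP csL.
have [le inj] : #|cl (induced e X) @: reached L P C| <= rank L P C /\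
    (rank L P C <= #|cl (induced e X) @: reached L P C| ->
     {in reached L P C &, forall x y, cl (induced e X) x = cl (induced e X) y ->
        cl (induced e L) x = cl (induced e L) y}).
  apply: card_coarser => x y _ _ /(eq_clP _ _ sL) /iLX xy.
  by apply/eq_clP.
have le' : rank X P0 C <= #|cl (induced e X) @: reached L P C|.
  exact/subset_leq_card/imsetS.
split; first exact: leq_trans le.
move=> ge x y xC yC xy.
have xL := subsetP CL x xC; have yL := subsetP CL y yC.
(* Either the connection stays in [L], or both ends reach [P] inside [L] and so are counted by its
   rank. *)
case: (connect_exit sep xL xy) => [[] // | [b bP xb]].
rewrite csX in xy.
case: (connect_exit sep yL xy) => [[_] | [b' b'P yb]]; first by rewrite csL.
apply/(eq_clP _ _ sL)/inj; first exact: leq_trans le'.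
- by rewrite inE xC; apply/existsP; exists b; rewrite bP csL.
- by rewrite inE yC; apply/existsP; exists b'; rewrite b'P csL.
- by apply/eq_clP => //; rewrite csX.
Qed.

End Rank.

(** * Segments of a path decomposition and their cutting into letters *)

Definition segment (V : finType) (B : nat -> {set V}) s t :=
  [set v | [exists i : 'I_t.+1, (s <= i) && (v \in B i)]].

Lemma segmentP (V : finType) (B : nat -> {set V}) s t v :
  reflect (exists2 i, s <= i <= t & v \in B i) (v \in segment B s t).
Proof.
rewrite inE; apply: (iffP existsP) => [[i /andP[si vi]] | [i /andP[si it] vi]].
  by exists i => //; rewrite si -ltnS ltn_ord.
by rewrite -ltnS in it; exists (Ordinal it); rewrite /= si.
Qed.

(* The width reached after cutting segments of rank at least [r] into letters
   of rank [r], when segments of larger rank have width [w]. *)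
Definition letter_width k w := w + k + 2 * k + 2 * k * (2 * k).
Definition chain_width k w :=
  let a := letter_width k w in
  let b := a + a + 2 * k * a in
  let c := 2 * a + 4 * k * a + a + 4 * k * a in
  c + b + 2 * k * b.

Section PathDecomposition.
Variables (V : finType) (e : rel V) (B : nat -> {set V}) (k : nat).
Hypothesis sym_e : symmetric e.
Hypothesis irr_e : irreflexive e.
Hypothesis B_interval : forall u i l j,
  i <= l -> l <= j -> u \in B i -> u \in B j -> u \in B l.
(** Demanded only of edges whose ends both occur in bags, so that it survives deleting a vertex from
    the bags while [e] stays the same. *)
Hypothesis B_edge : forall u v i j, e u v -> u \in B i -> v \in B j ->
  exists l, (u \in B l) && (v \in B l).
Hypothesis B_card : forall i, #|B i| <= k.

Local Notation seg := (segment B).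
Local Notation good := (decomposable e).
Local Notation ind := (induced e).

Lemma segment_cat s b t : s <= b -> b <= t -> seg s b :|: seg b t = seg s t.
Proof.
move=> sb bt; apply/setP=> v; rewrite in_setU; apply/orP/segmentP.
  by case=> /segmentP[i ? vi]; exists i => //; lia.
case=> i ? vi; case: (leqP i b) => ib; [left|right];
  by apply/segmentP; exists i => //; lia.
Qed.

Lemma segmentI s b t : s <= b -> b <= t -> seg s b :&: seg b t = B b.
Proof.
move=> sb bt; apply/setP=> v; rewrite in_setI; apply/andP/idP.
  case=> /segmentP[i /andP[_ ib] vi] /segmentP[j /andP[bj _] vj].
  exact: B_interval ib bj vi vj.
by move=> vb; split; apply/segmentP; exists b => //; lia.
Qed.

Lemma segment_disjoint s c d t : c <= d -> B c :&: B d = set0 ->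
  seg s c :&: seg d t = set0.
Proof.
move=> cd BB; apply/setP=> v; rewrite in_setI in_set0; apply/negP.
case/andP=> /segmentP[i /andP[_ ic] vi] /segmentP[j /andP[dj _] vj].
have: v \in B c :&: B d.
  rewrite inE (B_interval ic _ vi vj) ?(leq_trans cd) //=.
  by apply: (B_interval _ dj vi vj); apply: leq_trans cd.
by rewrite BB inE.
Qed.

Lemma sub_segment s t i : s <= i -> i <= t -> B i \subset seg s t.
Proof. by move=> si it; apply/subsetP=> v vi; apply/segmentP; exists i; rewrite ?si. Qed.

(** The bag holding the edge may lie outside the range; by the interval property the nearer of [B s]
    and [B t] then holds both ends. *)
Lemma segment_edge s t u v : s <= t -> u \in seg s t -> v \in seg s t -> e u v ->
  exists2 i, s <= i <= t & (u \in B i) && (v \in B i).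
Proof.
move=> st /segmentP[i /andP[si it] ui] /segmentP[j /andP[sj jt] vj] euv.
have [l /andP[ul vl]] := B_edge euv ui vj.
have [ls | sl] := leqP l s.
  exists s; first by rewrite leqnn.
  by rewrite (B_interval ls si ul ui) (B_interval ls sj vl vj).
have [lt | tl] := leqP l t; first by exists l; rewrite ?ul // (ltnW sl).
exists t; first by rewrite leqnn andbT.
by rewrite (B_interval it (ltnW tl) ui ul) (B_interval jt (ltnW tl) vj vl).
Qed.

Lemma segment_sep s b t u v : s <= b -> b <= t ->
  u \in seg s b -> v \in seg b t -> e u v -> (u \in seg b t) || (v \in seg s b).
Proof.
move=> sb bt us vt euv.
have [||i ? /andP[ui vi]] := segment_edge (leq_trans sb bt) _ _ euv.
- by rewrite -(segment_cat sb bt) in_setU us.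
- by rewrite -(segment_cat sb bt) in_setU vt orbT.
have [ib | bi] := leqP i b; apply/orP; [right | left];
  by apply/segmentP; exists i => //; lia.
Qed.

Local Notation rk s t := (rank e (seg s t) (B s) (B t)).

(** Instance of [rank_sub] in which [B b] guards the exits of [seg b c]; the second part will
    confine detours to the last block. *)
Lemma segment_rank_l s b c : s <= b -> b <= c -> rk s c <= rk b c /\
  (rk b c <= rk s c -> {in B c &, forall x y,
     connect (ind (seg s c)) x y -> connect (ind (seg b c)) x y}).
Proof.
move=> sb bc; apply: rank_sub => //.
- by rewrite -(segment_cat sb bc) subsetUr.
- move=> y z yR; rewrite -(segment_cat sb bc) in_setU => /orP[zL | ->]; last first.
    by rewrite orbT.
  rewrite sym_e => ezy; have [->|yL] := orP (segment_sep sb bc zL yR ezy).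
    by rewrite orbT.
  by rewrite -(segmentI sb bc) in_setI yL yR.
- exact: sub_segment.
- apply/subsetP=> x /setIP[xs /segmentP[i /andP[bi _] xi]].
  exact: B_interval sb bi xs xi.
Qed.

Lemma segment_rank_r s b c : s <= b -> b <= c -> rk s c <= rk s b.
Proof.
move=> sb bc; rewrite rankC // [leqRHS]rankC //.
apply: (proj1 (rank_sub sym_e _ _ _ _)).
- by rewrite -(segment_cat sb bc) subsetUl.
- move=> y z yL; rewrite -(segment_cat sb bc) in_setU => /orP[-> | zR] eyz.
    by rewrite orbT.
  have [yR|->] := orP (segment_sep sb bc yL zR eyz); last by rewrite orbT.
  by rewrite -(segmentI sb bc) in_setI yL yR.
- exact: sub_segment.
- apply/subsetP=> x /setIP[xc /segmentP[i /andP[_ ib] xi]].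
  exact: B_interval ib bc xi xc.
Qed.

Lemma segment_join w w' a b c : a <= b -> b <= c ->
  good w (seg a b) -> good w' (seg b c) -> good (w + w' + 2 * k * w') (seg a c).
Proof.
move=> ab bc g g'; rewrite -(segment_cat ab bc).
apply: decomposable_leq (decomposableU sym_e _ g g').
  by rewrite (segmentI ab bc) leq_add2l leq_mul2r leq_mul2l B_card !orbT.
move=> x y; exact: segment_sep.
Qed.

Lemma good_bag s : good k (seg s s).
Proof.
apply: (decomposable_leq _ (decomposable_card sym_e irr_e (seg s s))).
by rewrite -(setIid (seg s s)) segmentI.
Qed.

Lemma good_two_bags s : good (2 * k) (seg s s.+1).
Proof.
apply: (decomposable_leq _ (decomposable_card sym_e irr_e (seg s s.+1))).
have -> : seg s s.+1 = B s :|: B s.+1.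
  apply/setP=> v; rewrite in_setU; apply/segmentP/orP.
    case=> i /andP[si]; rewrite leq_eqVlt ltnS => /orP[/eqP-> | is_]; first by right.
    have -> : i = s by lia.
    by left.
  by case=> vB; [exists s | exists s.+1] => //; lia.
by apply: (leq_trans (leq_card_setU _ _)); rewrite mul2n -addnn leq_add.
Qed.

(* A decomposition of the segment from [s] to [c] whose bags are still small
   on the last block, which starts at [b]; [F0] is the part of the forest
   spanning this block. *)
Definition chain w1 w2 r s c := exists b F W F0,
  [/\ s <= b, b <= c, rk b c <= r,
      forest_decomposition (ind (seg s c)) (seg s c) F W
    & [/\ symmetric F0, subrel F0 F, (forall x y, F0 x y -> y \in seg b c),
          subrel (ind (seg b c)) (connect F0)
        & (forall x, x \in seg b c -> #|W x| <= w1) /\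
          (forall x, #|W x| <= w2)]].

(** The whole segment is the last block, and the whole forest is [F0]. *)
Lemma chain_start w w1 w2 r s c : s <= c -> rk s c <= r -> w <= w1 -> w <= w2 ->
  good w (seg s c) -> chain w1 w2 r s c.
Proof.
move=> sc rsc ww1 ww2 [F [W [D leW]]]; exists s, F, W, F; split=> //.
split=> //; first exact: fd_sym D.
- by move=> x y /(fd_sub D)/and3P[].
- exact: fd_span D.
- by split=> [x _ | x]; apply: leq_trans (leW x) _.
Qed.

Lemma chain_good w1 w2 r s c : chain w1 w2 r s c -> good w2 (seg s c).
Proof. by case=> b [F [W [F0 [_ _ _ D [_ _ _ _ [_ leW]]]]]]; exists F, W. Qed.

(** The block [seg d d'] is glued first; it is disjoint from the chain, so no bag grows. The
    connector [seg c d] follows, with detours in the two adjacent blocks only. Bags at a block thus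
    grow at most twice: up to [w1] for the connector on its left, up to [w2] for the one on its
    right. *)
Lemma chain_step w r s c d d' (w1 := 2 * w + 4 * k * w)
    (w2 := w1 + w + 4 * k * w) :
  s <= c -> c <= d -> d <= d' -> B c :&: B d = set0 ->
  good w (seg c d) -> good w (seg d d') -> rk d d' <= r -> r <= rk s c ->
  chain w1 w2 r s c -> chain w1 w2 r s d'.
Proof.
move=> sc cd dd' BB [F1 [W1 [D1 leW1]]] [F2 [W2 [D2 leW2]]] rdd' rsc.
case=> b [F [W [F0 [sb bc rbc D [sF0 F0F F0b cF0 [leWb leW]]]]]].
have XY0 : seg s c :&: seg d d' = set0 by apply: segment_disjoint.
have Fs x y : F x y -> y \in seg s c by move/(fd_sub D)/and3P=> [].
have [//|F3 [W3 [D3 FF3 F2F3 leW3 _]]] :=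
  glue D D2 (fd_sym D) (fun _ _ h => h) Fs _ leW2.
have {}F2F3 := F2F3 XY0.
have {}leW3 x : #|W3 x| <= #|W x| + #|W2 x|.
  by apply: leq_trans (leW3 x) _; rewrite XY0 cards0 muln0 mul0n addn0.
pose F00 := relU F0 F2; pose Z := seg b c :|: seg d d'.
have sF00 : symmetric F00 by move=> x y; rewrite /F00 /= sF0 (fd_sym D2).
have F00F3 : subrel F00 F3 by move=> x y /orP[/F0F/FF3|/F2F3].
have F00Z x y : F00 x y -> y \in Z.
  by rewrite in_setU => /orP[/F0b -> // | /(fd_sub D2)/and3P[_ _ ->]]; rewrite orbT.
have stay X1 X2 x y : X1 :&: X2 = set0 -> x \in X1 ->
    connect (relU (ind X1) (ind X2)) x y -> connect (ind X1) x y.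
  move=> X12 xX1 xy; suff [] : y \in X1 /\ connect (ind X1) x y by [].
  move: y xy; apply: connect_ind => [|y z [yX1 xy] yz]; first by rewrite connect0.
  have{} yz : ind X1 y z.
    case/orP: yz => // /and3P[_ yX2 _].
    by have := in_set0 y; rewrite -X12 in_setI yX1 yX2.
  split; first by have /and3P[] := yz.
  exact: connect_trans xy (connect1 yz).
have sM : (seg s c :|: seg d d') :&: seg c d = B c :|: B d.
  by rewrite setIUl (segmentI sc cd) (setIC (seg d d')) (segmentI cd dd').
have disj x : x \in B c -> x \in seg d d' -> False.
  move=> xc xd; have := in_set0 x; rewrite -XY0 in_setI xd andbT.
  by rewrite (subsetP (sub_segment sc (leqnn c)) x xc).
have disj' x : x \in B d -> x \in seg s c -> False.
  move=> xd xc; have := in_set0 x; rewrite -XY0 in_setI xc.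
  by rewrite (subsetP (sub_segment (leqnn d) dd') x xd).
(* From [B c], a connection stays in [seg s c], and as [rk b c <= r <= rk s c] it already exists in
   the last block. From [B d], it stays in the new block. *)
have F00c : {in (seg s c :|: seg d d') :&: seg c d &, forall x y,
    connect F3 x y -> connect F00 x y}.
  move=> x y; rewrite sM => xA yA /(connect_mono (fd_sub D3)) xy.
  case/setUP: xA => [xc | xd].
    have xs := subsetP (sub_segment sc (leqnn c)) x xc.
    have {}xy := stay _ _ _ _ XY0 xs xy.
    have yc : y \in B c.
      case/setUP: yA => // yd; case: (disj' y yd).
      move: y xy {yd}; apply: connect_ind => // y z _; by case/and3P.
    have [_ /(_ (leq_trans rbc rsc) x y xc yc xy)] := segment_rank_l sb bc.
    have cF : subrel (connect (ind (seg b c))) (connect F00).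
      apply: connect_sub => u v /cF0; apply: connect_mono => u' v' /= ->; done.
    exact: cF.
  have xs := subsetP (sub_segment (leqnn d) dd') x xd.
  have xy' : connect (ind (seg d d')) x y.
    apply: (stay _ (seg s c)) => //; first by rewrite setIC.
    by rewrite -(eq_connect (e := relU (ind (seg s c)) (ind (seg d d')))) // => u v /=;
      rewrite orbC.
  apply: (connect_sub _ xy') => u v /(fd_span D2).
  by apply: connect_mono => u' v' /= ->; rewrite orbT.
have [F4 [W4 [D4 F3F4 _ leW4 eqW4]]] := glue D3 D1 sF00 F00F3 F00Z F00c leW1.
(* The connector meets the rest in [B c :|: B d], which has at most [2 * k] vertices; hence the term
   [4 * k * w]. *)
have le4k x : #|W4 x| <= #|W3 x| + w + 4 * k * w.
  apply: leq_trans (leW4 x) _; apply: leq_add; first by rewrite leq_add2l.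
  rewrite leq_mul2r; apply/orP; right; rewrite -[4]/(2 * 2) -mulnA leq_mul2l /=.
  rewrite sM; apply: (leq_trans (leq_card_setU _ _)).
  by rewrite mul2n -addnn leq_add.
have sd' := leq_trans sc (leq_trans cd dd').
have eX : seg s c :|: seg d d' :|: seg c d = seg s d'.
  by rewrite setUAC (segment_cat sc cd) (segment_cat (leq_trans sc cd) dd').
(* The new last block starts at [d] and is spanned by [F2]. *)
exists d, F4, W4, F2; split=> //; first exact: leq_trans sc cd.
  rewrite -eX; apply: eq_forest_decomposition D4 => x y; rewrite eX.
  have sub a t : s <= a -> t <= d' -> subrel (ind (seg a t)) (ind (seg s d')).
    move=> sa td' u v /and3P[euv ua va] /=; rewrite euv /=.
    have subs : seg a t \subset seg s d'.
      by apply/subsetP=> z /segmentP[i ? zi]; apply/segmentP; exists i => //; lia.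
    by rewrite !(subsetP subs).
  apply/idP/idP.
    by case/orP=> [/orP[]|]; apply: sub; lia.
  case/and3P=> exy xs ys; have [i ? /andP[xi yi]] := segment_edge sd' xs ys exy.
  have inseg a t : a <= i <= t -> ind (seg a t) x y.
    by case/andP=> ai it; rewrite /= exy !(subsetP (sub_segment ai it)).
  have [ic | ci] := leqP i c; first by do 2!(apply/orP; left); apply: inseg; lia.
  have [id_ | di] := leqP i d; last first.
    by apply/orP; left; apply/orP; right; apply: inseg; lia.
  by apply/orP; right; apply: inseg; lia.
split.
- exact: fd_sym D2.
- by move=> x y /F2F3/F3F4.
- by move=> x y /(fd_sub D2)/and3P[].
- exact: fd_span D2.
have W0 x : x \notin seg s c -> #|W x| = 0.
  by move=> nx; rewrite (fd_bag0 D nx) cards0.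
have W20 x : x \notin seg d d' -> #|W2 x| = 0.
  by move=> nx; rewrite (fd_bag0 D2 nx) cards0.
have small x : x \in seg d d' -> #|W4 x| <= w1.
  move=> xd; have nx : x \notin seg s c.
    by apply/negP=> xc; have := in_set0 x; rewrite -XY0 in_setI xc xd.
  have := le4k x; have := leW3 x; have := leW2 x; rewrite (W0 x nx) /w1; lia.
split=> // x.
have [/small | nxd] := boolP (x \in seg d d'); first by rewrite /w2; lia.
have := leW3 x; rewrite (W20 x nxd) addn0 => le3.
have [xb | nxb] := boolP (x \in seg b c).
  have := le4k x; have := leWb x xb; rewrite /w2; lia.
(* A node of the connector outside the last block is outside the old chain, which meets the
   connector only in [B c]. *)
have [xm | nxm] := boolP (x \in seg c d).
  have nx : x \notin seg s c.
    apply: contra nxb => xs; apply: (subsetP (sub_segment bc (leqnn c))).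
    by rewrite -(segmentI sc cd) in_setI xs.
  have := le4k x; rewrite (W0 x nx) in le3; rewrite /w2 /w1; lia.
rewrite eqW4 //; first exact: leq_trans (leW x).
by rewrite in_setU negb_or nxb.
Qed.

Section Step.
Variables (r w0 : nat).
Hypothesis good_w0 : forall c d, c <= d ->
  (r < rk c d) || (B c :&: B d != set0) -> good w0 (seg c d).

Local Notation wl := (letter_width k w0).

(** The letter ends at the first [d] with rank at most [r] and disjoint end bags. One bag earlier,
    the segment is a single bag or falls under [good_w0]; joining the last two bags gives the
    formula of [letter_width]. If [t] fails the condition, the remainder needs no cut. *)
Lemma next_letter c t : c <= t -> good wl (seg c t) \/
  exists d, [/\ c < d, d <= t, rk c d <= r, B c :&: B d = set0
              & good wl (seg c d)].
Proof.
move=> ct.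
pose P d := [&& c < d, d <= t, rk c d <= r & B c :&: B d == set0].
have short d : c <= d -> d <= t -> ~~ P d -> good (w0 + k) (seg c d).
  rewrite leq_eqVlt => /orP[/eqP<- _ _ | cd dt nPd].
    exact: decomposable_leq (leq_addl _ _) (good_bag c).
  apply: decomposable_leq (leq_addr _ _) (good_w0 (ltnW cd) _).
  by move: nPd; rewrite /P cd dt /= negb_and -ltnNge.
have wl_ge : w0 + k <= wl by rewrite /letter_width; lia.
have [Pt | nPt] := boolP (P t); last first.
  by left; apply: decomposable_leq wl_ge (short t _ _ _).
have exP : exists d, P d by exists t.
case: (ex_minnP exP) => d Pd min_d.
have /and4P[cd dt rd /eqP BB] := Pd.
right; exists d; split=> //.
case: d Pd min_d cd dt rd BB => // d _ min_d cd dt _ _.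
apply: segment_join; [ | exact: leqnSn | | exact: good_two_bags] => //.
by apply: short => //; [exact: ltnW | apply/negP=> /min_d; rewrite ltnn].
Qed.

(** Each round appends a connector and a block. When the cutting stops, one or two pieces of joint
    width at most [b] remain and are joined to the chain across one bag. *)
Lemma good_chain s t : s <= t -> r <= rk s t -> good (chain_width k w0) (seg s t).
Proof.
move=> st rst; rewrite /chain_width.
set a := wl; set b := a + a + 2 * k * a.
set w1 := 2 * a + 4 * k * a; set w2 := w1 + a + 4 * k * a.
suff: forall n c, t - c < n -> s <= c -> c <= t -> chain w1 w2 r s c ->
    good (w2 + b + 2 * k * b) (seg s t).
  move=> H; case: (next_letter st) => [g | [d [sd dt rd _ g]]].
    by apply: decomposable_leq g; rewrite /w2 /w1 -/a; lia.
  apply: (H (t - d).+1 d) => //; first exact: ltnW.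
  by apply: (chain_start (ltnW sd) rd _ _ g); rewrite /w2 /w1 -/a; lia.
elim=> // n IHn c lt_n sc ct ch.
case: (next_letter ct) => [g | [d [cd dt rd BB g]]].
  apply: (segment_join sc ct (chain_good ch)).
  by apply: decomposable_leq g; rewrite /b -/a; lia.
case: (next_letter dt) => [g' | [d' [dd' d't rd' _ g']]].
  apply: (segment_join sc ct (chain_good ch)).
  exact: segment_join (ltnW cd) dt g g'.
apply: (IHn d') => //; first by lia.
  by lia.
apply: (chain_step sc (ltnW cd) (ltnW dd') BB g g' rd' _ ch).
(* Shortening a segment cannot lower its rank, so [r] bounds the rank of the chain from below. *)
exact: leq_trans rst (segment_rank_r sc ct).
Qed.

End Step.

(** Downward induction on the rank, run upwards on [j]: round [j] covers the ranks above [k - j]. At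
    [j = 0] there are none, as a rank is at most the size of a bag. *)
Lemma good_rank w0 j s t :
  (forall c d, c <= d -> B c :&: B d != set0 -> good w0 (seg c d)) ->
  s <= t -> (k < j + rk s t) || (B s :&: B t != set0) ->
  good (iter j (chain_width k) w0) (seg s t).
Proof.
move=> good_w0; elim: j s t => [|j IHj] s t st.
  case/orP=> [|/good_w0]; last exact.
  by rewrite add0n ltnNge (leq_trans (rank_leq_card _ _ _ _) (B_card t)).
case/orP=> [k_lt | BB]; last first.
  apply: decomposable_leq (IHj s t st _); last by rewrite BB orbT.
  by rewrite iterS /chain_width /letter_width; lia.
rewrite iterS; apply: (@good_chain (k - j)) => //; last by lia.
move=> c d cd /orP[rcd | BB]; apply: IHj => //; last by rewrite BB orbT.
by apply/orP; left; lia.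
Qed.

End PathDecomposition.

(** * Induction on the bag size *)

Fixpoint width_bound k :=
  if k is k'.+1 then iter k.+1 (chain_width k) (width_bound k').+1 else 0.

Theorem good_segment k (V : finType) (e : rel V) (B : nat -> {set V}) s t :
  symmetric e -> irreflexive e ->
  (forall u i l j, i <= l -> l <= j -> u \in B i -> u \in B j -> u \in B l) ->
  (forall u v i j, e u v -> u \in B i -> v \in B j ->
     exists l, (u \in B l) && (v \in B l)) ->
  (forall i, #|B i| <= k) -> s <= t ->
  decomposable e (width_bound k) (segment B s t).
Proof.
move=> sym_e irr_e; elim: k B s t => [|k IHk] B s t B_int B_edge B_card st.
  have -> : segment B s t = set0.
    apply/setP=> v; rewrite in_set0; apply/segmentP=> -[i _ vi].
    by have := B_card i; rewrite leqn0 cards_eq0 => /eqP B0; rewrite B0 inE in vi.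
  exact: decomposable0.
(* Ranks run from 0 to the bag size, whence the number of iterations in [width_bound]; the successor
   there pays for the vertex [p] removed below. *)
apply: (good_rank sym_e irr_e B_int B_edge B_card) => //; last first.
  by apply/orP; left; lia.
move=> c d cd /set0Pn[p /setIP[pc pd]].
have pB i : c <= i <= d -> p \in B i by case/andP=> ci id_; apply: B_int pc pd.
have pS : p \in segment B c d by apply/segmentP; exists c; rewrite ?leqnn.
apply: (decomposable_add_vertex sym_e irr_e pS).
(* Bags outside the range need not hold [p] and could stay too large, so they are emptied. *)
pose B' i := if c <= i <= d then B i :\ p else set0.
have inB' u i : u \in B' i = [&& c <= i <= d, u != p & u \in B i].
  by rewrite /B'; case: ifP; rewrite !inE.
have -> : segment B c d :\ p = segment B' c d.
  apply/setP=> v; rewrite in_setD1; apply/andP/segmentP.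
    by case=> nvp /segmentP[i cid vi]; exists i => //; rewrite inB' cid nvp.
  case=> i cid; rewrite inB' => /and3P[_ nvp vi]; split=> //.
  by apply/segmentP; exists i.
apply: IHk => //.
- move=> u i l j il lj; rewrite !inB' => /and3P[/andP[ci _] nup ui].
  case/and3P=> /andP[_ jd] _ uj; rewrite nup (B_int u i l j) // (leq_trans ci) //.
  by rewrite (leq_trans lj).
- move=> u v i j euv; rewrite !inB' => /and3P[ci nup ui] /and3P[cj nvp vj].
  have [||l cld /andP[ul vl]] := segment_edge B_int B_edge cd _ _ euv.
  + by apply/segmentP; exists i.
  + by apply/segmentP; exists j.
  by exists l; rewrite !inB' cld nup nvp ul.
- move=> i; rewrite /B'; case: ifP => [ci | _]; last by rewrite cards0.
  by have := B_card i; rewrite (cardsD1 p) pB.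
Qed.

(** * Numbering the bags along the path *)

Section PathGraph.
Variables (I : finType) (eT : rel I).

(** A longest path is closed under adjacency: a neighbour outside it would either extend it at an
    end or give an inner vertex a third neighbour. Connectivity does the rest. *)
Lemma hamiltonian_path : is_path_graph eT ->
  exists s : seq I, [/\ uniq s, sorted eT s & forall x, x \in s].
Proof.
case=> -[[sT irrT] [[I_gt0 conT] _]] degT.
pose P n := [exists s : n.-tuple I, uniq s && sorted eT s].
have P_leq n : P n -> n <= #|I|.
  by case/existsP=> s /andP[/card_uniqP us _]; rewrite -(size_tuple s) -us max_card.
have P0 : exists n, P n by exists 0; apply/existsP; exists [tuple].
have inP s : uniq s -> sorted eT s -> P (size s).
  by move=> us ss; apply/existsP; exists (in_tuple s); rewrite us.
case: (ex_maxnP P0 P_leq) => n /existsP[[s /= /eqP size_s] /andP[us ss]] max_n.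
rewrite -{}size_s in max_n; exists s; split=> //.
have too_long t : uniq t -> sorted eT t -> size t = (size s).+1 -> False.
  by move=> ut st et; have := max_n _ (inP t ut st); rewrite et ltnn.
have s_closed z z' : z \in s -> eT z z' -> z' \in s.
  move=> zs zz'; apply: contraT => nz's; exfalso.
  case/splitPr: zs us ss nz's too_long {max_n} => p1 p2 us ss nz's too_long.
  (* If [p1] or [p2] is empty, [z] is an end of the path. *)
  case/lastP: p1 us ss nz's too_long => [|p1 a] us ss nz's too_long.
    apply: (too_long (z' :: z :: p2)) => //=; first by rewrite nz's.
    by rewrite sT zz'.
  case: p2 us ss nz's too_long => [|b p2] us ss nz's too_long.
    apply: (too_long (rcons (rcons p1 a ++ [:: z]) z')); last by rewrite size_rcons.
      by rewrite rcons_uniq nz's.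
    rewrite cats1 in ss *; case: (p1) ss => [|c p] /=; rewrite ?rcons_path.
      by rewrite zz' !andbT.
    by move=> ->; rewrite last_rcons.
  have az : eT z a.
    rewrite cat_rcons in ss; rewrite sT.
    by case: (p1) ss => [|c p] /=; rewrite ?cat_path => /andP[] // _ /= /and3P[].
  have zb : eT z b.
    rewrite cat_rcons in ss.
    case: (p1) ss => [|c p] /=; first by case/and3P.
    by rewrite cat_path => /andP[_] /= /and4P[].
  have ab : a != b.
    apply: contraTneq us => ->; rewrite cat_uniq /= !mem_rcons mem_head.
    by rewrite /= !orbT andbF.
  have az' : a != z'.
    by apply: contraNneq nz's => <-; rewrite cat_rcons mem_cat mem_head orbT.
  have bz' : b != z'.
    by apply: contraNneq nz's => <-; rewrite mem_cat 2!in_cons eqxx !orbT.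
  have := degT z; rewrite leqNgt => /negP; apply.
  apply: (@leq_trans #|[set a; b; z']|).
    by rewrite setUC cardsU1 cards2 ab !inE negb_or eq_sym az' eq_sym bz'.
  by apply/subset_leq_card/subsetP=> x; rewrite !inE => /orP[/orP[]|] /eqP->.
case: s us ss {max_n inP} too_long s_closed => [|x0 s] us ss too_long s_closed.
  by have [x _] := card_gt0P I_gt0; case: (too_long [:: x]).
move=> x; move: x (conT x0 x); apply: connect_ind; first exact: mem_head.
by move=> y z ys yz; apply: s_closed yz.
Qed.

(** Otherwise the edge closes the stretch from position [i] to position [j] into a cycle. *)
Lemma sorted_acyclic_edge (s : seq I) x0 i j : symmetric eT -> acyclic_graph eT ->
  uniq s -> sorted eT s -> i < j -> j < size s ->
  eT (nth x0 s i) (nth x0 s j) -> j = i.+1.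
Proof.
move=> sT acT us ss ij js eij.
apply/eqP; rewrite eqn_leq ij andbT leqNgt; apply/negP=> lt_ij.
have size_d : (j - i).+1 <= size (drop i s) by rewrite size_drop; lia.
have size_t := size_takel size_d.
have := acT (take (j - i).+1 (drop i s)); rewrite take_uniq ?drop_uniq // size_t.
have gt2 : 2 < (j - i).+1 by lia.
move=> /(_ isT gt2) /negP; apply.
have sst : sorted eT (take (j - i).+1 (drop i s)) by apply/take_sorted/drop_sorted.
rewrite (cycle_path x0) -nth_last size_t /= nth_take // nth_drop subnKC ?(ltnW ij) //.
have: nth x0 (take (j - i).+1 (drop i s)) 0 = nth x0 s i.
  by rewrite nth_take // nth_drop addn0.
by case: (take _ _) sst => //= y t -> ->; rewrite sT eij.
Qed.

End PathGraph.

Lemma pathwidth_bags (V : finType) (e : rel V) k : pathwidth_lt e k ->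
  exists (B : nat -> {set V}) n,
    [/\ forall u i l j, i <= l -> l <= j -> u \in B i -> u \in B j -> u \in B l,
        forall u v, e u v -> exists l, (u \in B l) && (v \in B l),
        forall i, #|B i| <= k
      & segment B 0 n = setT].
Proof.
case=> I [eT [W [pT [[_ [covT edgeT]] leW]]]].
have [s [us ss all_s]] := hamiltonian_path pT.
have [[[sT _] [[I_gt0 _] acT]] _] := pT.
have [x0 _] := card_gt0P I_gt0.
(* Positions beyond the path get an empty bag, so the conditions hold for all indices. *)
pose B i := if i < size s then W (nth x0 s i) else set0.
have WB u x : u \in W x -> u \in B (index x s).
  by move=> ux; rewrite /B index_mem all_s nth_index.
have inB u i : u \in B i -> i < size s /\ u \in W (nth x0 s i).
  by rewrite /B; case: ifP => // _; rewrite inE.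
exists B, (size s); split.
- move=> u i l j il lj /inB[i_s ui] /inB[js uj].
  have ls := leq_ltn_trans lj js.
  apply: contraT => nul; exfalso.
  have nli : i != l by apply: contraNneq nul => <-; rewrite /B i_s.
  have := (proj2 (covT u)) _ _ ui uj => cij.
  (* If [B l] missed [u], a walk through nodes holding [u] would stay below [l], since an edge going
     up the path advances by one position. *)
  suff: index (nth x0 s j) s < l by rewrite index_uniq // ltnNge lj.
  move: (nth x0 s j) cij; apply: connect_ind => [|a b lta /and3P[ab ua ub]].
    by rewrite index_uniq // ltn_neqAle nli.
  rewrite ltn_neqAle; apply/andP; split.
    by apply: contraNneq nul => <-; apply: WB.
  rewrite leqNgt; apply/negP=> lb.
  have := @sorted_acyclic_edge _ _ s x0 (index a s) (index b s) sT acT us ss.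
  rewrite !nth_index // index_mem => /(_ (ltn_trans lta lb) (all_s b) ab) eb.
  by move: lb; rewrite eb ltnS leqNgt lta.
- move=> u v /edgeT[x /andP[ux vx]]; exists (index x s).
  by rewrite !WB.
- by move=> i; rewrite /B; case: ifP; rewrite ?cards0.
- apply/setP=> u; rewrite in_setT; apply/segmentP.
  have [[x ux] _] := covT u; exists (index x s); last exact: WB.
  by rewrite index_size.
Qed.

Theorem theorem1p1 :
  exists f : nat -> nat,
    forall (k : nat), 0 < k ->
    forall (V : finType) (e : rel V),
      simple_graph e -> connected_graph e -> pathwidth_lt e k ->
      exists (eT : rel V) (W : V -> {set V}),
        is_tree eT /\ subrel eT e /\
        tree_decomposition e eT W /\ width_le W (f k) /\
        forall v : V, v \in W v.
Proof.
exists width_bound => k _ V e [sym_e irr_e] [V_gt0 con_e] /pathwidth_bags.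
case=> B [n [B_int B_edge B_card B_all]].
have B_edge' u v i j : e u v -> u \in B i -> v \in B j ->
    exists l, (u \in B l) && (v \in B l) by move=> /B_edge.
have := good_segment sym_e irr_e B_int B_edge' B_card (leq0n n).
rewrite B_all => -[F [W [D leW]]].
have e_ind x y : induced e setT x y = e x y by rewrite /= !inE !andbT.
have Fe : subrel F e by move=> x y /(fd_sub D); rewrite e_ind.
have sF := fd_sym D.
have treeF : is_tree F.
  split; first by split=> // x; apply: contraFF (irr_e x) => /Fe.
  split; last exact: forest_acyclic (fd_forest D).
  split=> // x y; apply: connect_sub (con_e x y) => u v euv.
  by apply: (fd_span D); rewrite e_ind.
exists F, W; do !split=> //.
- by exists u; apply: (fd_self D).
(* Two nodes holding [u] are linked through the node [u]. *)
- move=> x y ux uy.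
  have sym_u : symmetric (bag_rel F W u).
    by move=> a b /=; rewrite sF andbA andbAC -andbA.
  have := connect_trans _ (fd_linked D uy); apply.
  by rewrite (sym_connect_sym sym_u); apply: (fd_linked D).
- by move=> u v euv; apply: (fd_cover D); rewrite e_ind.
(* Width is bag size minus one, so [width_le] leaves one vertex of slack. *)
- by move=> x; apply: leq_trans (leW x) _.
- by move=> v; apply: (fd_self D).
Qed.
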